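(* Let $\Lambda$ be a finite set, $\mathcal H_\Lambda=\bigotimes_{x\in\Lambda}\mathcal H_x$ with each $\mathcal H_x$ finite dimensional, $\rho_\Lambda\in\mathcal S_\Lambda$, and $\sigma_\Lambda=\bigotimes_{x\in\Lambda}\sigma_x$ a full-rank product state. Then $$D(\rho_\Lambda\|\sigma_\Lambda)\le\sum_{x\in\Lambda}D_x(\rho_\Lambda\|\sigma_\Lambda).$$
   Context: $D(\rho\|\sigma)=\operatorname{tr}[\rho(\log\rho-\log\sigma)]$. For $x\in\Lambda$ with $x^c=\Lambda\setminus\{x\}$, $D_x(\rho_\Lambda\|\sigma_\Lambda):=D(\rho_\Lambda\|\sigma_\Lambda)-D(\rho_{x^c}\|\sigma_{x^c})$, where $\rho_{x^c},\sigma_{x^c}$ are the reduced states on $x^c$. *)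

(* Defs.v *)
From Stdlib Require Import Reals ClassicalEpsilon.
From mathcomp Require Import all_boot.

Set Implicit Arguments.
Unset Strict Implicit.
Unset Printing Implicit Defensive.

Local Open Scope R_scope.

Definition C := (R * R)%type.
Definition C0 : C := (0, 0).
Definition C1 : C := (1, 0).
Definition RtoC (r : R) : C := (r, 0).
Definition Cre (a : C) : R := fst a.
Definition Cadd (a b : C) : C := (fst a + fst b, snd a + snd b).
Definition Copp (a : C) : C := (- fst a, - snd a).
Definition Cmul (a b : C) : C :=
  (fst a * fst b - snd a * snd b, fst a * snd b + snd a * fst b).
Definition Cconj (a : C) : C := (fst a, - snd a).

Definition mx (I : finType) := I -> I -> C.

Definition mx0 (I : finType) : mx I := fun _ _ => C0.
Definition mx1 (I : finType) : mx I := fun i j => if i == j then C1 else C0.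
Definition msub (I : finType) (A B : mx I) : mx I := fun i j => Cadd (A i j) (Copp (B i j)).
Definition mmul (I : finType) (A B : mx I) : mx I :=
  fun i j => \big[Cadd/C0]_(k : I) Cmul (A i k) (B k j).
Definition adj (I : finType) (A : mx I) : mx I := fun i j => Cconj (A j i).
Definition mtr (I : finType) (A : mx I) : C := \big[Cadd/C0]_(i : I) A i i.
Definition diagR (I : finType) (l : I -> R) : mx I :=
  fun i j => if i == j then RtoC (l i) else C0.

Definition quad (I : finType) (A : mx I) (v : I -> C) : C :=
  \big[Cadd/C0]_(i : I) \big[Cadd/C0]_(j : I) Cmul (Cconj (v i)) (Cmul (A i j) (v j)).

Definition unitary (I : finType) (U : mx I) : Prop :=
  mmul U (adj U) = @mx1 I /\ mmul (adj U) U = @mx1 I.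

Definition is_state (I : finType) (rho : mx I) : Prop :=
  adj rho = rho /\
  (forall v : I -> C, 0 <= Cre (quad rho v)) /\
  mtr rho = C1.

Definition full_rank (I : finType) (A : mx I) : Prop :=
  exists B : mx I, mmul A B = @mx1 I /\ mmul B A = @mx1 I.

(* Matrix logarithm via spectral decomposition of a positive semidefinite
   matrix A = U diag(l) U^*, log A := U diag(ln l) U^*.  Stdlib's ln is 0 on
   nonpositive reals, so eigenvalue 0 is sent to 0 (support convention);
   hence tr[rho log rho] uses 0 log 0 = 0. *)
Definition is_log (I : finType) (A L : mx I) : Prop :=
  exists (U : mx I) (l : I -> R),
    unitary U /\ (forall i, 0 <= l i) /\
    A = mmul U (mmul (diagR l) (adj U)) /\
    L = mmul U (mmul (diagR (fun i => ln (l i))) (adj U)).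

Definition mlog (I : finType) (A : mx I) : mx I :=
  epsilon (inhabits (@mx0 I)) (is_log A).

Definition relent (I : finType) (rho sigma : mx I) : R :=
  Cre (mtr (mmul rho (msub (mlog rho) (mlog sigma)))).

(* ---------- the lattice: sites 'I_n, site k has dimension (d k).+1 ---------- *)
Definition dmax (n : nat) (d : 'I_n -> nat) : nat := ((\max_(k : 'I_n) d k).+1)%N.

(* configurations on a region A of sites: coordinates in A range over the
   basis of H_k, coordinates outside A are fixed to 0 (a dummy filler);
   so cfg d A indexes an orthonormal basis of H_A = (x)_{k in A} H_k. *)
Definition good (n : nat) (d : 'I_n -> nat) (A : {set 'I_n})
  (f : {ffun 'I_n -> 'I_(dmax d)}) : bool :=
  [forall k, if k \in A then (nat_of_ord (f k) <= d k)%N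
             else (nat_of_ord (f k) == 0)%N].

Definition cfg (n : nat) (d : 'I_n -> nat) (A : {set 'I_n}) : finType :=
  {f : {ffun 'I_n -> 'I_(dmax d)} | @good n d A f}.

Definition prod_mx (n : nat) (d : 'I_n -> nat)
  (s : forall k : 'I_n, mx 'I_((d k).+1)) : mx (cfg d setT) :=
  fun f g => \big[Cmul/C1]_(k : 'I_n)
     s k (inord (nat_of_ord (val f k))) (inord (nat_of_ord (val g k))).

Definition ptrace (n : nat) (d : 'I_n -> nat) (A : {set 'I_n})
  (rho : mx (cfg d setT)) : mx (cfg d A) :=
  fun a b => \big[Cadd/C0]_(f : cfg d setT) \big[Cadd/C0]_(g : cfg d setT |
       [forall k, if k \in A then (val f k == val a k) && (val g k == val b k)
                  else val f k == val g k])
     rho f g.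

Arguments ptrace {n d} A rho.

Definition relent_x (n : nat) (d : 'I_n -> nat) (x : 'I_n)
  (rho sigma : mx (cfg d setT)) : R :=
  (relent rho sigma - relent (ptrace [set~ x] rho) (ptrace [set~ x] sigma)).

(* Main.v *)
(** Since sigma is a product, every term involving log sigma cancels and the claim is the quantum
    Han inequality, S(Lambda) >= sum_x (S(Lambda) - S(x^c)).  Ordering the sites, strong
    subadditivity bounds S(Lambda) - S(x^c) by S({<= x}) - S({< x}), and the sum telescopes.

    Strong subadditivity is monotonicity of D under partial traces, applied to rho and
    rho_{x^c} (x) 1.  In terms of eigenbases (e_i), (f_j) and eigenvalues p_i, q_j,
    D(rho||tau) = sum_ij |<f_j,e_i>|^2 p_i (ln p_i - ln q_j).  Writing
    ln x = int_0^1 (x - 1) / (1 + t (x - 1)) dt reduces monotonicity of D to that of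
    G_t = sum_ij |<f_j,e_i>|^2 p_i^2 / ((1 - t) p_i + t q_j), and G_t is the supremum over X of
    2 Re tr(rho X') - (1 - t) tr(rho X' X) - t tr(tau X X') with X' the adjoint of X: restricting X to operators of
    the form Y (x) 1 gives the same supremum for the reduced pair.  No integral is needed: midpoint
    Riemann sums suffice because everything is finite-dimensional. *)
From Stdlib Require Import Reals Lra FunctionalExtensionality ClassicalEpsilon.
From HB Require Import structures.
From mathcomp Require Import all_boot.
From mathcomp Require ssralg ssrnum matrix spectral complex.
From mathcomp Require Import Rstruct.
Require Import Defs.

Set Implicit Arguments.
Unset Strict Implicit.
Unset Printing Implicit Defensive.

Local Open Scope R_scope.

(** * Complex numbers and matrices *)

Lemma C_ext (a b : C) : fst a = fst b -> snd a = snd b -> a = b.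
Proof. by case: a => ? ?; case: b => ? ? /= -> ->. Qed.

Lemma C_ring : ring_theory C0 C1 Cadd Cmul (fun a b => Cadd a (Copp b)) Copp eq.
Proof. by split=> *; apply: C_ext => /=; ring. Qed.
Add Ring C_ring : C_ring.

Lemma CaddA : associative Cadd. Proof. by move=> a b c; ring. Qed.
Lemma CaddC : commutative Cadd. Proof. by move=> a b; ring. Qed.
Lemma Cadd0 : left_id C0 Cadd. Proof. by move=> a; ring. Qed.
Lemma CmulA : associative Cmul. Proof. by move=> a b c; ring. Qed.
Lemma CmulC : commutative Cmul. Proof. by move=> a b; ring. Qed.
Lemma Cmul1 : left_id C1 Cmul. Proof. by move=> a; ring. Qed.
Lemma Cmul1r : right_id C1 Cmul. Proof. by move=> a; ring. Qed.
Lemma Cmul0 : left_zero C0 Cmul. Proof. by move=> a; ring. Qed.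
Lemma Cmul0r : right_zero C0 Cmul. Proof. by move=> a; ring. Qed.
Lemma CmulDl : left_distributive Cmul Cadd. Proof. by move=> a b c; ring. Qed.
Lemma CmulDr : right_distributive Cmul Cadd. Proof. by move=> a b c; ring. Qed.

HB.instance Definition _ := Monoid.isComLaw.Build C C0 Cadd CaddA CaddC Cadd0.
HB.instance Definition _ := Monoid.isComLaw.Build C C1 Cmul CmulA CmulC Cmul1.
HB.instance Definition _ := Monoid.isMulLaw.Build C C0 Cmul Cmul0 Cmul0r.
HB.instance Definition _ := Monoid.isAddLaw.Build C Cmul Cadd CmulDl CmulDr.

Definition Cabs2 (a : C) : R := fst a * fst a + snd a * snd a.

Lemma Cabs2_ge0 a : 0 <= Cabs2 a.
Proof. rewrite /Cabs2; nra. Qed.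

Lemma CconjK a : Cconj (Cconj a) = a.
Proof. by apply: C_ext => /=; ring. Qed.

Lemma CconjM a b : Cconj (Cmul a b) = Cmul (Cconj a) (Cconj b).
Proof. by apply: C_ext => /=; ring. Qed.

Lemma CconjD a b : Cconj (Cadd a b) = Cadd (Cconj a) (Cconj b).
Proof. by apply: C_ext => /=; ring. Qed.

Lemma Cconj0 : Cconj C0 = C0.
Proof. by apply: C_ext => /=; ring. Qed.

Lemma Cconj1 : Cconj C1 = C1.
Proof. by apply: C_ext => /=; ring. Qed.

Lemma CconjR r : Cconj (RtoC r) = RtoC r.
Proof. by apply: C_ext => /=; ring. Qed.

Lemma Cmul_conj a : Cmul (Cconj a) a = RtoC (Cabs2 a).
Proof. by apply: C_ext; rewrite /Cabs2 /=; ring. Qed.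

Lemma CreM r a : Cre (Cmul (RtoC r) a) = r * Cre a.
Proof. by rewrite /Cre /=; ring. Qed.

Lemma Csum_conj (I : finType) (P : pred I) (F : I -> C) :
  Cconj (\big[Cadd/C0]_(i | P i) F i) = \big[Cadd/C0]_(i | P i) Cconj (F i).
Proof. exact: (big_morph Cconj CconjD Cconj0). Qed.

Lemma Cprod_conj (I : finType) (P : pred I) (F : I -> C) :
  Cconj (\big[Cmul/C1]_(i | P i) F i) = \big[Cmul/C1]_(i | P i) Cconj (F i).
Proof. exact: (big_morph Cconj CconjM Cconj1). Qed.

Lemma Cre_sum (I : finType) (P : pred I) (F : I -> C) :
  Cre (\big[Cadd/C0]_(i | P i) F i) = \big[Rplus/R0]_(i | P i) Cre (F i).
Proof. exact: (big_morph Cre (fun _ _ => erefl) erefl). Qed.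

Lemma RtoC_prod (I : finType) (P : pred I) (F : I -> R) :
  RtoC (\big[Rmult/R1]_(i | P i) F i) = \big[Cmul/C1]_(i | P i) RtoC (F i).
Proof.
apply: (big_morph RtoC _ erefl) => a b.
by apply: C_ext => /=; ring.
Qed.

Lemma Csum_pick (I : finType) (j : I) (F : I -> C) :
  \big[Cadd/C0]_(i : I) (if i == j then F i else C0) = F j.
Proof. by rewrite -big_mkcond big_pred1_eq. Qed.

Lemma Rsum_le (I : finType) (P : pred I) (F G : I -> R) :
  (forall i, P i -> F i <= G i) ->
  \big[Rplus/R0]_(i | P i) F i <= \big[Rplus/R0]_(i | P i) G i.
Proof. by move=> h; elim/big_rec2: _ => [|i x y Pi]; [lra | move: (h i Pi); lra]. Qed.

Lemma Rsum_ge0 (I : finType) (P : pred I) (F : I -> R) :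
  (forall i, P i -> 0 <= F i) -> 0 <= \big[Rplus/R0]_(i | P i) F i.
Proof. by move=> h; elim/big_rec: _ => [|i x Pi]; [lra | move: (h i Pi); lra]. Qed.

Lemma Rsum_opp (I : finType) (P : pred I) (F : I -> R) :
  \big[Rplus/R0]_(i | P i) - F i = - \big[Rplus/R0]_(i | P i) F i.
Proof. by elim/big_rec2: _ => [|i x y _ ->]; ring. Qed.

Lemma Rsum_sub (I : finType) (P : pred I) (F G : I -> R) :
  \big[Rplus/R0]_(i | P i) (F i - G i) =
  \big[Rplus/R0]_(i | P i) F i - \big[Rplus/R0]_(i | P i) G i.
Proof. by rewrite big_split /= Rsum_opp. Qed.

Lemma Rsum_ge0_eq0 (I : finType) (F : I -> R) :
  (forall i, 0 <= F i) -> \big[Rplus/R0]_(i : I) F i = 0 -> forall i, F i = 0.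
Proof.
move=> F0 + i; rewrite (bigD1 i) //= => h.
have := @Rsum_ge0 I (fun j => j != i) F (fun j _ => F0 j).
by move: (F0 i) => ? ?; lra.
Qed.

Section Matrices.
Variable I : finType.
Implicit Types A B X Y U : mx I.

Lemma mx_ext A B : (forall i j, A i j = B i j) -> A = B.
Proof. by move=> h; do 2![apply: functional_extensionality => ?]; apply: h. Qed.

Lemma mmulA A B X : mmul A (mmul B X) = mmul (mmul A B) X.
Proof.
apply: mx_ext => i j; rewrite /mmul.
under eq_bigr do rewrite big_distrr /=.
rewrite exchange_big /=; apply: eq_bigr => k _; rewrite big_distrl /=.
by apply: eq_bigr => l _; rewrite CmulA.
Qed.

Lemma mmul1 A : mmul (@mx1 I) A = A.
Proof.
apply: mx_ext => i j; rewrite -[RHS](Csum_pick i (fun k => A k j)) /mmul /mx1.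
by apply: eq_bigr => k _; rewrite eq_sym; case: ifP => _; ring.
Qed.

Lemma mmul1r A : mmul A (@mx1 I) = A.
Proof.
apply: mx_ext => i j; rewrite -[RHS](Csum_pick j (fun k => A i k)) /mmul /mx1.
by apply: eq_bigr => k _; case: ifP => _; ring.
Qed.

Lemma adjM A B : adj (mmul A B) = mmul (adj B) (adj A).
Proof.
apply: mx_ext => i j; rewrite /adj /mmul Csum_conj.
by apply: eq_bigr => k _; rewrite CconjM CmulC.
Qed.

Lemma adjK A : adj (adj A) = A.
Proof. by apply: mx_ext => i j; rewrite /adj CconjK. Qed.

Lemma adj1 : adj (@mx1 I) = @mx1 I.
Proof.
by apply: mx_ext => i j; rewrite /adj /mx1 eq_sym; case: ifP => _; rewrite ?Cconj0 ?Cconj1.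
Qed.

Lemma mtr_mulC A B : mtr (mmul A B) = mtr (mmul B A).
Proof.
rewrite /mtr /mmul exchange_big /=; apply: eq_bigr => i _.
by apply: eq_bigr => j _; rewrite CmulC.
Qed.

Lemma diag_mul l A i j : mmul (diagR l) A i j = Cmul (RtoC (l i)) (A i j).
Proof.
rewrite -(Csum_pick i (fun k => Cmul (RtoC (l k)) (A k j))) /mmul /diagR.
by apply: eq_bigr => k _; rewrite eq_sym; case: eqP => [->|_]; ring.
Qed.

Lemma mul_diag l A i j : mmul A (diagR l) i j = Cmul (A i j) (RtoC (l j)).
Proof.
rewrite -(Csum_pick j (fun k => Cmul (A i k) (RtoC (l k)))) /mmul /diagR.
by apply: eq_bigr => k _; case: eqP => [->|_]; ring.
Qed.

Lemma unitaryK U A : unitary U -> mmul U (mmul (adj U) A) = A.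
Proof. by case=> h _; rewrite mmulA h mmul1. Qed.

Lemma unitaryKV U A : unitary U -> mmul (adj U) (mmul U A) = A.
Proof. by case=> _ h; rewrite mmulA h mmul1. Qed.

(** The eigenvalues are real of any sign, so this covers Hermitian operators; nonnegativity is
    carried separately. *)
Definition is_spec (A U : mx I) (l : I -> R) : Prop :=
  unitary U /\ A = mmul U (mmul (diagR l) (adj U)).

Definition psd (A : mx I) : Prop :=
  adj A = A /\ forall v : I -> C, 0 <= Cre (quad A v).

(* The probability of outcome [j] when [A] is measured in the basis of columns of [V]. *)
Definition wt (V A : mx I) (j : I) : R := Cre (mmul (adj V) (mmul A V) j j).

Lemma tr_spec A U l Z : is_spec A U l ->
  mtr (mmul A Z) = \big[Cadd/C0]_i Cmul (RtoC (l i)) (mmul (adj U) (mmul Z U) i i).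
Proof.
case=> _ ->; rewrite -!mmulA mtr_mulC -!mmulA.
by apply: eq_bigr => i _; rewrite diag_mul.
Qed.

Lemma Re_tr_spec A U l Z : is_spec A U l ->
  Cre (mtr (mmul A Z)) = \big[Rplus/R0]_i (l i * wt U Z i).
Proof.
by move=> h; rewrite (tr_spec _ h) Cre_sum; apply: eq_bigr => i _; rewrite CreM.
Qed.

Lemma tr_spec1 A U l : is_spec A U l -> Cre (mtr A) = \big[Rplus/R0]_i l i.
Proof.
move=> h; rewrite -[A]mmul1r (Re_tr_spec _ h); apply: eq_bigr => i _.
by rewrite /wt mmul1 (proj2 (proj1 h)) /mx1 eqxx /=; ring.
Qed.

Lemma spec_diag A U l : is_spec A U l -> mmul (adj U) (mmul A U) = diagR l.
Proof. by case=> hU ->; rewrite -!mmulA unitaryKV // (proj2 hU) mmul1r. Qed.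

Lemma wt_spec A U l i : is_spec A U l -> wt U A i = l i.
Proof. by move=> h; rewrite /wt (spec_diag h) /diagR eqxx. Qed.

Lemma wt_quad V A j : wt V A j = Cre (quad A (fun i => V i j)).
Proof.
rewrite /wt /quad /mmul /adj; congr Cre; apply: eq_bigr => k _.
by rewrite big_distrr.
Qed.

Lemma wt_ge0 V A j : psd A -> 0 <= wt V A j.
Proof. by case=> _ h; rewrite wt_quad. Qed.

Lemma spec_ge0 A U l i : psd A -> is_spec A U l -> 0 <= l i.
Proof. by move=> hA h; rewrite -(wt_spec i h); apply: wt_ge0. Qed.

End Matrices.

(** * The spectral theorem *)

Section SpectralTheorem.
Import ssralg ssrnum matrix spectral complex GRing.Theory Num.Theory.
Import sesquilinear.
Local Open Scope ring_scope.
Local Open Scope complex_scope.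
Local Notation "M ^t*" := (map_mx Num.conj (M ^T)) (at level 30) : ring_scope.
Variable I : finType.

Let Cx := complex R.

Definition of_cx (z : Cx) : C := (complex.Re z, complex.Im z).
Definition to_cx (z : C) : Cx := Complex z.1 z.2.

(** Transport along the enumeration of [I]. Only [of_matrix] is shown to respect products, identity
    and adjoints; [to_matrix] serves as its right inverse. *)
Definition of_matrix (M : 'M[Cx]_#|I|) : mx I :=
  fun i j => of_cx (M (enum_rank i) (enum_rank j)).
Definition to_matrix (A : mx I) : 'M[Cx]_#|I| :=
  \matrix_(i, j) to_cx (A (enum_val i) (enum_val j)).

Lemma to_matrixK A : of_matrix (to_matrix A) = A.
Proof.
apply: mx_ext => i j; rewrite /of_matrix mxE !enum_rankK.
by case: (A i j).
Qed.

Lemma of_matrixM M N : of_matrix (M *m N) = mmul (of_matrix M) (of_matrix N).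
Proof.
apply: mx_ext => i j; rewrite /of_matrix /mmul mxE.
rewrite (big_morph of_cx (id1 := C0) (op1 := Cadd)) //; last by case=> ? ?; case.
rewrite (reindex (@enum_rank I)) /=; last exact: onW_bij (@enum_rank_bij I).
apply: eq_bigr => k _; case: (M _ _) => a b; case: (N _ _) => c d.
by [].
Qed.

Lemma of_matrix1 : of_matrix 1%:M = @mx1 I.
Proof.
apply: mx_ext => i j; rewrite /of_matrix /mx1 mxE (inj_eq enum_rank_inj).
by case: eqP.
Qed.

Lemma of_matrix_adj M : of_matrix (M ^t*) = adj (of_matrix M).
Proof.
apply: mx_ext => i j; rewrite /of_matrix /adj !mxE.
by case: (M _ _).
Qed.

Lemma of_matrix_diag (d : 'rV_#|I|) : d \is a realmx ->
  of_matrix (diag_mx d) = diagR (fun i => complex.Re (d ord0 (enum_rank i))).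
Proof.
move=> /mxOverP dR; apply: mx_ext => i j.
rewrite /of_matrix /diagR mxE (inj_eq enum_rank_inj).
have := dR ord0 (enum_rank i); case: eqP => // _; case: (d _ _) => a b /=.
move/complex_realP => [c [-> ->]].
by [].
Qed.

Lemma hermitian_spec (A : mx I) : adj A = A -> exists U l, is_spec A U l.
Proof.
move=> hA; set M := to_matrix A.
have hM : M \is hermsymmx.
  apply/is_hermitianmxP; rewrite expr0 scale1r.
  apply/matrixP => i j; rewrite !mxE -[in LHS]hA /adj.
  by case: (A _ _).
have uP := spectral_unitarymx M; set P := spectralmx M in uP.
have dR := hermitian_spectral_diag_real hM.
have /orthomx_spectralP := hermitian_normalmx hM.
rewrite -/P invmx_unitary // => eM.
(* [eM] reads M = P^-1 D P with P unitary, so the eigenvectors are the columns of the adjoint of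
   P. *)
exists (of_matrix (P ^t*)), (fun i => complex.Re (spectral_diag M ord0 (enum_rank i))).
split; last first.
  rewrite -{1}[A]to_matrixK -/M {1}eM -mulmxA !of_matrixM of_matrix_diag //.
  by rewrite of_matrix_adj adjK.
have PP : P *m P ^t* = 1%:M by apply/unitarymxP.
have PP' : P ^t* *m P = 1%:M by apply: mulmx1C.
by split; rewrite {1 2}of_matrix_adj adjK -of_matrix_adj -of_matrixM ?PP ?PP' of_matrix1.
Qed.

End SpectralTheorem.

(** * Riemann sums for the logarithm *)

Lemma Rabs_le_iff x y : Rabs x <= y <-> - y <= x <= y.
Proof. by rewrite /Rabs; case: Rcase_abs => h; lra. Qed.

(** The upper bound is [1 + u <= exp u] at u = ln (b / a); exchanging [a] and [b] gives the lower
    one. *)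
Lemma ln_bounds a b : 0 < a -> 0 < b -> (b - a) / b <= ln b - ln a <= (b - a) / a.
Proof.
have key : forall x y, 0 < x -> 0 < y -> ln y - ln x <= (y - x) / x.
  move=> x y x0 y0; have yx0 : 0 < y / x by apply: Rdiv_lt_0_compat.
  rewrite -[ln y - ln x]/(ln y + - ln x) -ln_Rinv // -ln_mult //; last exact: Rinv_0_lt_compat.
  have := exp_ineq1_le (ln (y * / x)); rewrite exp_ln //.
  have -> : (y - x) / x = y * / x - 1 by (field; lra).
  by lra.
move=> a0 b0; split; last exact: key.
have := key _ _ b0 a0; have -> : (b - a) / b = - ((a - b) / b) by (field; lra).
by lra.
Qed.

(** Midpoints avoid both ends of [0, 1]: the integrand is divided by t, and the average [wavg] with
    p > 0 can vanish at t = 1. *)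
Definition midpoint (N k : nat) : R := (INR k + / 2) / INR N.

Lemma midpoint_bounds N k : (k < N)%N -> 0 < midpoint N k < 1.
Proof.
move=> kN; have k0 := pos_INR k.
have : INR k + 1 <= INR N by rewrite -S_INR; apply: le_INR; apply/leP.
move=> h; have N0 : 0 < INR N by lra.
split; first by apply: Rdiv_lt_0_compat; lra.
apply: (Rmult_lt_reg_r (INR N)) => //; rewrite /midpoint /Rdiv Rmult_assoc Rinv_l; lra.
Qed.

(* A Riemann sum of [ln x = \int_0^1 (x - 1) / (1 + t (x - 1)) dt]. *)
Lemma ln_riemann (x : R) (N : nat) : 0 < x -> (0 < N)%N ->
  Rabs (\big[Rplus/R0]_(k < N) ((x - 1) / INR N / (1 + midpoint N k * (x - 1))) - ln x)
    <= (x - 1) * (1 - / x) / INR N.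
Proof.
move=> x0 N0.
have N0' : 0 < INR N by apply: lt_0_INR; apply/ltP.
(* The values of 1 + t (x - 1) at the grid points t = k / N: they run from 1 to x in steps of [dl],
   and the integral up to k / N is [ln (a k)]. *)
pose a k := 1 + INR k / INR N * (x - 1).
set dl := (x - 1) / INR N.
have aS k : a k.+1 = a k + dl by rewrite /a /dl S_INR; field; lra.
have a_gt0 k : (k <= N)%N -> 0 < a k.
  move=> kN; have k0 := pos_INR k; have kN' : INR k <= INR N by apply: le_INR; apply/leP.
  have : 0 <= INR k / INR N by apply: Rmult_le_pos => //; apply: Rlt_le; apply: Rinv_0_lt_compat.
  have : INR k / INR N <= 1.
    apply: (Rmult_le_reg_r (INR N)) => //; rewrite /Rdiv Rmult_assoc Rinv_l; lra.
  rewrite /a; set u := INR k / INR N => u1 u0; nra.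
have midpointE k : 1 + midpoint N k * (x - 1) = a k + dl / 2.
  by rewrite /midpoint /a /dl; field; lra.
(* The n-th summand and the increment of [ln] both lie between [dl / a n.+1] and [dl / a n], for
   either sign of [dl]. The error of a step is at most the difference of these bounds, and the
   differences telescope. *)
have main n : (n <= N)%N ->
    Rabs (\big[Rplus/R0]_(k < n) (dl / (1 + midpoint N k * (x - 1))) - ln (a n))
      <= dl * (1 - / a n).
  elim: n => [_|n IH nN].
    rewrite big_ord0 /a /= /Rdiv !Rmult_0_l Rplus_0_r ln_1 Rinv_1 -[R0]/0.
    rewrite Rminus_0_r Rabs_R0; lra.
  have an := a_gt0 n (ltnW nN); have aSn := a_gt0 _ nN.
  move: (IH (ltnW nN)) => {}IH; rewrite big_ord_recr /= midpointE.
  have [l1 l2] := ln_bounds an aSn.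
  have e1 : (a n.+1 - a n) / a n.+1 = dl / a n.+1 by (rewrite aS; field; rewrite -aS; lra).
  have e2 : (a n.+1 - a n) / a n = dl / a n by (rewrite aS; field; lra).
  rewrite e1 in l1; rewrite e2 in l2.
  have m0 : 0 < a n + dl / 2 by rewrite aS in aSn; lra.
  have b1 : dl / a n.+1 <= dl / (a n + dl / 2).
    have : dl / (a n + dl / 2) - dl / a n.+1 = (dl * dl / 2) / ((a n + dl / 2) * a n.+1).
      by rewrite aS; field; rewrite -aS; lra.
    have : 0 <= (dl * dl / 2) / ((a n + dl / 2) * a n.+1).
      apply: Rmult_le_pos; first by nra.
      by apply: Rlt_le; apply: Rinv_0_lt_compat; apply: Rmult_lt_0_compat.
    by lra.
  have b2 : dl / (a n + dl / 2) <= dl / a n.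
    have : dl / a n - dl / (a n + dl / 2) = (dl * dl / 2) / (a n * (a n + dl / 2)).
      by field; lra.
    have : 0 <= (dl * dl / 2) / (a n * (a n + dl / 2)).
      apply: Rmult_le_pos; first by nra.
      by apply: Rlt_le; apply: Rinv_0_lt_compat; apply: Rmult_lt_0_compat.
    by lra.
  move: IH; rewrite /Rdiv in l1 l2 b1 b2 *.
  move/Rabs_le_iff => [i1 i2]; apply/Rabs_le_iff.
  set S := bigop _ _ _ in i1 i2 *; lra.
have aN : a N = x by (rewrite /a; field; lra).
move: (main N (leqnn N)); rewrite aN.
by have -> : dl * (1 - / x) = (x - 1) * (1 - / x) / INR N by (rewrite /dl; field; lra).
Qed.

Definition wavg (t p q : R) : R := (1 - t) * p + t * q.

Lemma wavg_ge0 t p q : 0 < t < 1 -> 0 <= p -> 0 <= q -> 0 <= wavg t p q.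
Proof. rewrite /wavg; nra. Qed.

Lemma wavg_gt0 t p q : 0 < t < 1 -> 0 < p -> 0 <= q -> 0 < wavg t p q.
Proof. rewrite /wavg; nra. Qed.

(** With x = q / p one has [wavg t p q] = p (1 + t (x - 1)), so (p - p^2 / wavg) / t = p (x - 1) /
    (1 + t (x - 1)). The sum is p times the Riemann sum of ln x = ln q - ln p. If p = 0, every term
    is 0. *)
Lemma kl_riemann (p q : R) : 0 <= p -> 0 <= q -> (q = 0 -> p = 0) ->
  exists K, 0 <= K /\ forall N, (0 < N)%N ->
    Rabs (\big[Rplus/R0]_(k < N)
            (/ INR N * ((p - p * p / wavg (midpoint N k) p q) / midpoint N k))
          + p * (ln p - ln q)) <= K / INR N.
Proof.
move=> p0 q0 qp; case: (Req_EM_T p 0) => [->|pn0].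
  exists 0; split=> [|N N0]; first lra.
  rewrite big1 => [|k _]; last by rewrite /Rdiv; ring.
  by rewrite Rmult_0_l Rplus_0_l Rabs_R0 /Rdiv; lra.
have {}p0 : 0 < p by lra.
have {}q0 : 0 < q by case: q0 qp => // <- /(_ erefl); lra.
have x0 : 0 < q / p by apply: Rdiv_lt_0_compat.
set x := q / p in x0.
have K0 : 0 <= (x - 1) * (1 - / x).
  have -> : (x - 1) * (1 - / x) = (x - 1) * (x - 1) / x by (field; lra).
  apply: Rmult_le_pos; first exact: Rle_0_sqr.
  by apply: Rlt_le; apply: Rinv_0_lt_compat.
exists (p * ((x - 1) * (1 - / x))); split=> [|N N0]; first by apply: Rmult_le_pos; lra.
have N0' : 0 < INR N by apply: lt_0_INR; apply/ltP.
have lnx : ln x = ln q - ln p.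
  by rewrite /x /Rdiv ln_mult; [rewrite ln_Rinv // | | apply: Rinv_0_lt_compat].
have h := ln_riemann x0 N0.
have -> : \big[Rplus/R0]_(k < N) (/ INR N * ((p - p * p / wavg (midpoint N k) p q) / midpoint N k)) =
   p * \big[Rplus/R0]_(k < N) ((x - 1) / INR N / (1 + midpoint N k * (x - 1))).
  rewrite big_distrr /=; apply: eq_bigr => k _.
  have t0 := midpoint_bounds (ltn_ord k).
  have m0 := wavg_gt0 t0 p0 (Rlt_le _ _ q0).
  have e : wavg (midpoint N k) p q = p * (1 + midpoint N k * (x - 1)).
    by rewrite /wavg /x; field; lra.
  have e' : 0 < 1 + midpoint N k * (x - 1).
    by apply: (Rmult_lt_reg_l p) => //; rewrite -e; lra.
  rewrite e; field; split; [|split; [|split]]; lra.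
move: h; set S := bigop _ _ _; move=> h.
have -> : p * S + p * (ln p - ln q) = p * (S - ln x) by rewrite lnx; ring.
rewrite Rabs_mult (Rabs_pos_eq p); last lra.
rewrite /Rdiv in h *; rewrite Rmult_assoc; apply: Rmult_le_compat_l; lra.
Qed.

(** * Monotonicity of the relative entropy *)

Section Resolvent.
Variable I : finType.
Variables (rho tau U V : mx I) (p q : I -> R).
Hypothesis rhoP : is_spec rho U p.
Hypothesis tauP : is_spec tau V q.
Hypothesis p_ge0 : forall i, 0 <= p i.
Hypothesis q_ge0 : forall j, 0 <= q j.

Let hU : unitary U := proj1 rhoP.
Let hV : unitary V := proj1 tauP.

Definition overlap (V U : mx I) (j i : I) : R := Cabs2 (mmul (adj V) U j i).

(** The matrix [adj V] times [U] is unitary, so its columns are unit vectors. *)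
Lemma sum_overlap i : \big[Rplus/R0]_j overlap V U j i = 1.
Proof.
have : mmul (adj (mmul (adj V) U)) (mmul (adj V) U) = @mx1 I.
  by rewrite adjM adjK -!mmulA (unitaryK _ hV) (proj2 hU).
move/(congr1 (fun A => Cre (A i i))); rewrite /mx1 eqxx /= /mmul Cre_sum.
move=> h; apply: etrans h.
by apply: eq_bigr => j _; rewrite /overlap {1}/adj Cmul_conj.
Qed.

Lemma wt_overlap j : wt V rho j = \big[Rplus/R0]_i (overlap V U j i * p i).
Proof.
rewrite /wt (proj2 rhoP).
have -> : mmul (adj V) (mmul (mmul U (mmul (diagR p) (adj U))) V) =
  mmul (mmul (adj V) U) (mmul (diagR p) (adj (mmul (adj V) U))).
  by rewrite adjM adjK !mmulA.
rewrite /overlap; set W := mmul (adj V) U.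
rewrite {1}/mmul Cre_sum; apply: eq_bigr => i _; rewrite diag_mul /adj /Cabs2 /Cre /=.
by ring.
Qed.

(** It sees [A] and [B] only through traces against products of [X] and [adj X], so it is preserved
    by any multiplicative, adjoint-preserving map compatible with those traces. *)
Definition res_form (t : R) (A B X : mx I) : R :=
  2 * Cre (mtr (mmul A (adj X))) - (1 - t) * Cre (mtr (mmul A (mmul (adj X) X)))
  - t * Cre (mtr (mmul B (mmul X (adj X)))).

(** The quantity G_t. A term with p = q = 0 has denominator 0, but its numerator makes it 0 under
    total division. *)
Definition res_sup (t : R) : R :=
  \big[Rplus/R0]_j \big[Rplus/R0]_i
    (overlap V U j i * (p i * p i / wavg t (p i) (q j))).

(** In the coordinates Y = V' X U, with ' the adjoint, the trace of rho X' X weights |Y_ji|^2 by p_i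
    and that of tau X X' weights it by q_j. The functional thus splits into independent scalar
    quadratics, one per entry of Y. *)
Lemma res_formE t X (Y := mmul (adj V) (mmul X U)) (W := mmul (adj V) U) :
  res_form t rho tau X =
  \big[Rplus/R0]_j \big[Rplus/R0]_i
    (p i * (2 * Cre (Cmul (Cconj (Y j i)) (W j i)))
     - wavg t (p i) (q j) * Cabs2 (Y j i)).
Proof.
have e1 i : wt U (adj X) i = \big[Rplus/R0]_j Cre (Cmul (Cconj (Y j i)) (W j i)).
  rewrite /wt.
  have -> : mmul (adj U) (mmul (adj X) U) = mmul (adj Y) W.
    by rewrite /Y /W !adjM adjK -!mmulA unitaryK.
  by rewrite {1}/mmul Cre_sum; apply: eq_bigr => j _; rewrite /adj.
have e2 i : wt U (mmul (adj X) X) i = \big[Rplus/R0]_j Cabs2 (Y j i).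
  rewrite /wt.
  have -> : mmul (adj U) (mmul (mmul (adj X) X) U) = mmul (adj Y) Y.
    by rewrite /Y !adjM adjK -!mmulA unitaryK.
  by rewrite {1}/mmul Cre_sum; apply: eq_bigr => j _; rewrite /adj Cmul_conj.
have e3 j : wt V (mmul X (adj X)) j = \big[Rplus/R0]_i Cabs2 (Y j i).
  rewrite /wt.
  have -> : mmul (adj V) (mmul (mmul X (adj X)) V) = mmul Y (adj Y).
    by rewrite /Y !adjM adjK -!mmulA (unitaryK _ hU).
  by rewrite {1}/mmul Cre_sum; apply: eq_bigr => i _; rewrite /adj CmulC Cmul_conj.
rewrite /res_form !(Re_tr_spec _ rhoP) (Re_tr_spec _ tauP).
under eq_bigr do rewrite e1 big_distrr /=.
under [X in _ - _ * X - _]eq_bigr do rewrite e2 big_distrr /=.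
under [X in _ - _ - _ * X]eq_bigr do rewrite e3 big_distrr /=.
rewrite exchange_big [X in _ - _ * X - _]exchange_big /=.
rewrite !big_distrr -!Rsum_sub /=; apply: eq_bigr => j _.
rewrite !big_distrr -!Rsum_sub /=; apply: eq_bigr => i _.
by rewrite /wavg; ring.
Qed.

Lemma res_form_le t X : 0 < t < 1 -> res_form t rho tau X <= res_sup t.
Proof.
move=> t01; rewrite res_formE; apply: Rsum_le => j _; apply: Rsum_le => i _.
rewrite /overlap; set y := mmul _ (mmul X U) j i; set w := mmul _ U j i.
case: (Req_EM_T (p i) 0) => [->|pn0].
  have := wavg_ge0 t01 (Rle_refl 0) (q_ge0 j).
  have := Cabs2_ge0 y; rewrite /Rdiv !Rmult_0_l !Rmult_0_r.
  by move=> a b; have := Rmult_le_pos _ _ b a; lra.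
have p0 : 0 < p i by have := p_ge0 i; lra.
have m0 := wavg_gt0 t01 p0 (q_ge0 j); set m := wavg _ _ _ in m0 *.
rewrite /Cabs2 /Cre /=; move: (y.1) (y.2) (w.1) (w.2) => a b c d.
(* Completing the square: the scalar quadratic is maximal at Y_ji = p_i W_ji / m. *)
have -> : (c * c + d * d) * (p i * p i / m) =
  p i * (2 * (a * c - - b * d)) - m * (a * a + b * b)
  + m * ((a - p i * c / m) * (a - p i * c / m) + (b - p i * d / m) * (b - p i * d / m)).
  by field; lra.
have := Rle_0_sqr (a - p i * c / m); have := Rle_0_sqr (b - p i * d / m); rewrite /Rsqr.
move=> h1 h2; have := Rmult_le_pos _ _ (Rlt_le _ _ m0) (Rplus_le_le_0_compat _ _ h2 h1).
by lra.
Qed.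

Lemma res_form_attained t : 0 < t < 1 -> exists X, res_form t rho tau X = res_sup t.
Proof.
move=> t01.
(* The entrywise maximiser found by completing the square, carried back to an operator by X = V Y
   U'. *)
pose Y j i := Cmul (RtoC (p i / wavg t (p i) (q j))) (mmul (adj V) U j i).
exists (mmul V (mmul Y (adj U))); rewrite res_formE.
rewrite -!mmulA (proj2 hU) mmul1r (unitaryKV _ hV).
apply: eq_bigr => j _; apply: eq_bigr => i _; rewrite /overlap /Y.
set w := mmul _ U j i.
case: (Req_EM_T (p i) 0) => [->|pn0]; first by rewrite /Cabs2 /Cre /Rdiv /=; ring.
have p0 : 0 < p i by have := p_ge0 i; lra.
have m0 := wavg_gt0 t01 p0 (q_ge0 j); set m := wavg _ _ _ in m0 *.
by rewrite /Cabs2 /Cre /=; field; lra.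
Qed.

(** The relative entropy in the two eigenbases. Since [ln 0] is 0 here, later results add a support
    condition: outcomes with [q j = 0] have probability 0. *)
Definition kl : R :=
  \big[Rplus/R0]_j \big[Rplus/R0]_i (overlap V U j i * (p i * (ln (p i) - ln (q j)))).

Lemma klE : kl = \big[Rplus/R0]_i (p i * ln (p i)) - \big[Rplus/R0]_j (wt V rho j * ln (q j)).
Proof.
have -> : \big[Rplus/R0]_i (p i * ln (p i)) =
    \big[Rplus/R0]_j \big[Rplus/R0]_i (overlap V U j i * (p i * ln (p i))).
  rewrite exchange_big /=; apply: eq_bigr => i _.
  by rewrite -big_distrl /= sum_overlap; ring.
rewrite -Rsum_sub; apply: eq_bigr => j _.
rewrite wt_overlap big_distrl -Rsum_sub /=; apply: eq_bigr => i _; ring.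
Qed.

(** The scalar estimate is applied to each pair (j, i), weighted by its overlap; there are finitely
    many pairs, so the error constants add up to one [K]. *)
Lemma kl_approx : (forall j, q j = 0 -> wt V rho j = 0) ->
  exists K, 0 <= K /\ forall N, (0 < N)%N ->
    Rabs (\big[Rplus/R0]_(k < N)
            (/ INR N * ((\big[Rplus/R0]_i p i - res_sup (midpoint N k)) / midpoint N k)) + kl)
      <= K / INR N.
Proof.
move=> supp.
pose S N j i := \big[Rplus/R0]_(k < N)
   (/ INR N * ((p i - p i * p i / wavg (midpoint N k) (p i) (q j)) / midpoint N k)).
have : forall j i, exists K, 0 <= K /\ forall N, (0 < N)%N ->
    Rabs (overlap V U j i * (S N j i + p i * (ln (p i) - ln (q j)))) <= K / INR N.
  move=> j i; have o0 : 0 <= overlap V U j i by apply: Cabs2_ge0.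
  case: (Req_EM_T (overlap V U j i) 0) => [->|on0].
    exists 0; split=> [|N _]; first lra.
    by rewrite Rmult_0_l Rabs_R0 /Rdiv; lra.
  (* The weight at [j] is a sum of nonnegative terms overlap times p_i; if it vanishes, a nonzero
     overlap forces p_i = 0. *)
  have qp : q j = 0 -> p i = 0.
    move/supp; rewrite wt_overlap => /Rsum_ge0_eq0 h.
    have {}h : overlap V U j i * p i = 0.
      by apply: h => k; apply: Rmult_le_pos => //; apply: Cabs2_ge0.
    by case: (Rmult_integral _ _ h).
  have [K [K0 hK]] := kl_riemann (p_ge0 i) (q_ge0 j) qp.
  exists (overlap V U j i * K); split=> [|N N0]; first exact: Rmult_le_pos.
  rewrite Rabs_mult (Rabs_pos_eq _ o0) /Rdiv Rmult_assoc.
  by apply: Rmult_le_compat_l => //; apply: hK.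
move=> h; have {h} [K hK] := fin_all_exists (fun j => fin_all_exists (h j)).
exists (\big[Rplus/R0]_j \big[Rplus/R0]_i K j i); split=> [|N N0].
  by apply: Rsum_ge0 => j _; apply: Rsum_ge0 => i _; case: (hK j i).
have -> : \big[Rplus/R0]_(k < N)
      (/ INR N * ((\big[Rplus/R0]_i p i - res_sup (midpoint N k)) / midpoint N k)) =
    \big[Rplus/R0]_j \big[Rplus/R0]_i (overlap V U j i * S N j i).
  have e (k : 'I_N) : / INR N * ((\big[Rplus/R0]_i p i - res_sup (midpoint N k)) / midpoint N k) =
    \big[Rplus/R0]_j \big[Rplus/R0]_i (overlap V U j i *
      (/ INR N * ((p i - p i * p i / wavg (midpoint N k) (p i) (q j)) / midpoint N k))).
    (* The overlaps in a column sum to 1, so the trace spreads over the pairs (j, i). *)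
    have -> : \big[Rplus/R0]_i p i = \big[Rplus/R0]_j \big[Rplus/R0]_i (overlap V U j i * p i).
      rewrite exchange_big /=; apply: eq_bigr => i _.
      by rewrite -big_distrl /= sum_overlap; ring.
    rewrite -Rsum_sub /Rdiv big_distrl big_distrr /=; apply: eq_bigr => j _.
    rewrite -Rsum_sub big_distrl big_distrr /=; apply: eq_bigr => i _; ring.
  rewrite (eq_bigr _ (fun k _ => e k)).
  rewrite exchange_big /=; apply: eq_bigr => j _.
  by rewrite exchange_big /=; apply: eq_bigr => i _; rewrite -big_distrr.
rewrite /kl -big_split /= /Rdiv big_distrl /=.
elim/big_rec2: _ => [|j x y _ IH]; first by rewrite Rabs_R0; lra.
apply: Rle_trans (Rabs_triang _ _) _; apply: Rplus_le_compat => //.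
rewrite -big_split /= big_distrl /=.
elim/big_rec2: _ => [|i x' y' _ IH']; first by rewrite Rabs_R0; lra.
apply: Rle_trans (Rabs_triang _ _) _; apply: Rplus_le_compat => //.
by rewrite -Rmult_plus_distr_l; case: (hK j i) => _; apply.
Qed.

End Resolvent.

(* The X' attaining [res_sup] for the images lifts to a competitor [pi X'] for the originals. *)
Theorem kl_monotone (I I' : finType) (rho tau U V : mx I) (p q : I -> R)
    (rho' tau' U' V' : mx I') (p' q' : I' -> R) (pi : mx I' -> mx I) :
  is_spec rho U p -> is_spec tau V q -> is_spec rho' U' p' -> is_spec tau' V' q' ->
  (forall i, 0 <= p i) -> (forall i, 0 <= q i) ->
  (forall i, 0 <= p' i) -> (forall i, 0 <= q' i) ->
  (forall j, q j = 0 -> wt V rho j = 0) ->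
  (forall j, q' j = 0 -> wt V' rho' j = 0) ->
  (forall X, pi (adj X) = adj (pi X)) ->
  (forall X Y, pi (mmul X Y) = mmul (pi X) (pi Y)) ->
  mtr rho = mtr rho' ->
  (forall X, mtr (mmul rho (pi X)) = mtr (mmul rho' X)) ->
  (forall X, mtr (mmul tau (pi X)) = mtr (mmul tau' X)) ->
  kl U' V' p' q' <= kl U V p q.
Proof.
move=> h1 h2 h1' h2' p0 q0 p0' q0' supp supp' piA piM trE rhoE tauE.
have [K [K0 hK]] := kl_approx h1 h2 p0 q0 supp.
have [K' [K0' hK']] := kl_approx h1' h2' p0' q0' supp'.
have sup_le t : 0 < t < 1 -> res_sup U' V' p' q' t <= res_sup U V p q t.
  move=> t01; have [X <-] := res_form_attained h1' h2' p0' q0' t01.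
  apply: Rle_trans (res_form_le h1 h2 p0 q0 (pi X) t01).
  by rewrite /res_form -!piA -!piM !rhoE tauE; lra.
have sumE : \big[Rplus/R0]_i p i = \big[Rplus/R0]_i p' i.
  by rewrite -(tr_spec1 h1) -(tr_spec1 h1') trE.
(* The Riemann sums approximate minus [kl], so a smaller [res_sup] gives a larger sum and a smaller
   [kl], up to the two errors. *)
have bound N : (0 < N)%N -> kl U' V' p' q' - kl U V p q <= (K + K') / INR N.
  move=> N0; have N0' : 0 < INR N by apply: lt_0_INR; apply/ltP.
  move: (hK N N0) (hK' N N0) => /Rabs_le_iff a /Rabs_le_iff b.
  have : \big[Rplus/R0]_(k < N)
            (/ INR N * ((\big[Rplus/R0]_i p i - res_sup U V p q (midpoint N k)) / midpoint N k)) <=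
         \big[Rplus/R0]_(k < N)
            (/ INR N * ((\big[Rplus/R0]_i p' i - res_sup U' V' p' q' (midpoint N k)) / midpoint N k)).
    apply: Rsum_le => k _; have t01 := midpoint_bounds (ltn_ord k).
    apply: Rmult_le_compat_l; first by apply: Rlt_le; apply: Rinv_0_lt_compat.
    apply: Rmult_le_compat_r; first by apply: Rlt_le; apply: Rinv_0_lt_compat; lra.
    by rewrite sumE; have := sup_le _ t01; lra.
  by rewrite /Rdiv Rmult_plus_distr_r -/(Rdiv K _) -/(Rdiv K' _); lra.
case: (Rle_lt_dec (kl U' V' p' q') (kl U V p q)) => // lt.
(* A positive gap [e] would contradict [bound] as soon as N exceeds (K + K') / e. *)
pose e := kl U' V' p' q' - kl U V p q.
have e0 : 0 < e by rewrite /e; lra.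
have [N hN] := INR_unbounded ((K + K') / e).
have N0 : 0 < INR N.
  apply: Rle_lt_trans hN; apply: Rmult_le_pos; first lra.
  by apply: Rlt_le; apply: Rinv_0_lt_compat.
have N0' : (0 < N)%N by apply/ltP; apply: INR_lt.
have := bound N N0'; rewrite -/e => /(Rmult_le_compat_r (INR N) _ _ (Rlt_le _ _ N0)).
rewrite /Rdiv Rmult_assoc Rinv_l ?Rmult_1_r; last lra.
move: hN => /(Rmult_lt_compat_r e _ _ e0); rewrite /Rdiv Rmult_assoc Rinv_l; lra.
Qed.

(** * Entropy and strong subadditivity *)

Section Entropy.
Variable I : finType.
Implicit Types A B U V : mx I.

Lemma psd_spec A : psd A -> exists U l, is_spec A U l /\ forall i, 0 <= l i.
Proof.
move=> hA; have [U [l h]] := hermitian_spec (proj1 hA).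
by exists U, l; split=> // i; apply: spec_ge0 h.
Qed.

(** The functional calculus does not depend on the diagonalisation. With W = V' U, comparing the two
    gives q_i W_ij = W_ij l_j, so W_ij is nonzero only where q_i = l_j; hence W also intertwines
    f(q) and f(l). *)
Lemma is_log_unique A U l V q : is_spec A U l -> is_spec A V q -> forall f : R -> R,
  mmul U (mmul (diagR (fun i => f (l i))) (adj U)) =
  mmul V (mmul (diagR (fun i => f (q i))) (adj V)).
Proof.
move=> hA hB f; have [hU eU] := hA; have [hV eV] := hB.
set W := mmul (adj V) U.
have comm : mmul (diagR q) W = mmul W (diagR l).
  rewrite -(spec_diag hA) -(spec_diag hB) /W -!mmulA.
  by rewrite !(unitaryK _ hV) !(unitaryK _ hU).
have commf : mmul (diagR (fun i => f (q i))) W = mmul W (diagR (fun i => f (l i))).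
  apply: mx_ext => i j; move/(congr1 (fun X => X i j)): comm.
  rewrite !diag_mul !mul_diag; set w := W i j => e.
  have [e1 e2] : q i * w.1 = l j * w.1 /\ q i * w.2 = l j * w.2.
    by move: (congr1 fst e) (congr1 snd e) => /=; lra.
  case: (Req_EM_T (q i) (l j)) => [->|ne]; first by rewrite CmulC.
  have w1 : w.1 = 0 by apply: (Rmult_eq_reg_l (q i - l j)); lra.
  have w2 : w.2 = 0 by apply: (Rmult_eq_reg_l (q i - l j)); lra.
  by apply: C_ext => /=; rewrite w1 w2; ring.
rewrite -[LHS](unitaryK _ hV) [X in mmul V X = _]mmulA -/W [X in mmul V X = _]mmulA -commf.
by rewrite -!mmulA (proj1 hU) mmul1r.
Qed.

(** Uniqueness makes the choice by [epsilon] harmless: the logarithm may be computed in any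
    eigenbasis at hand. *)
Lemma mlog_spec A U l : is_spec A U l -> (forall i, 0 <= l i) ->
  mlog A = mmul U (mmul (diagR (fun i => ln (l i))) (adj U)).
Proof.
move=> h l0.
have : exists L, is_log A L by do 3!eexists; split; [exact: (proj1 h)|split=> //; split=> //; exact: (proj2 h)].
move/(epsilon_spec (inhabits (@mx0 I))) => [V [q [hV [q0 [eA eL]]]]].
by rewrite /mlog eL; apply: (is_log_unique (conj hV eA) h).
Qed.

Lemma Re_tr_mlog A B V q : is_spec B V q -> (forall i, 0 <= q i) ->
  Cre (mtr (mmul A (mlog B))) = \big[Rplus/R0]_j (wt V A j * ln (q j)).
Proof.
move=> h q0; rewrite (mlog_spec h q0) mtr_mulC.
rewrite (@Re_tr_spec _ _ V (fun i => ln (q i))); last by split; first exact: (proj1 h).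
by apply: eq_bigr => i _; ring.
Qed.

(** Minus the von Neumann entropy. *)
Definition negent A : R := Cre (mtr (mmul A (mlog A))).

Lemma negentE A U l : is_spec A U l -> (forall i, 0 <= l i) ->
  negent A = \big[Rplus/R0]_i (l i * ln (l i)).
Proof.
move=> h l0; rewrite /negent (Re_tr_mlog _ h l0).
by apply: eq_bigr => i _; rewrite (wt_spec _ h).
Qed.

Lemma relent_negent A B : relent A B = negent A - Cre (mtr (mmul A (mlog B))).
Proof.
rewrite /relent /negent /mtr !Cre_sum -Rsum_sub; apply: eq_bigr => i _.
rewrite /mmul !Cre_sum -Rsum_sub; apply: eq_bigr => j _.
by rewrite /msub /Cre /=; ring.
Qed.

(** The eigenvalues lie in [0, 1], where l ln l is nonpositive. *)
Lemma negent_le0 A : psd A -> Cre (mtr A) = 1 -> negent A <= 0.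
Proof.
move=> hA tA; have [U [l [h l0]]] := psd_spec hA.
rewrite (negentE h l0); apply: (Rle_trans _ (\big[Rplus/R0]_(i : I) R0)); last first.
  by rewrite big1 //; apply: Rle_refl.
apply: Rsum_le => i _.
have l1 : l i <= 1.
  rewrite -tA (tr_spec1 h) (bigD1 i) //=.
  by have := @Rsum_ge0 I (fun j => j != i) l (fun j _ => l0 j); lra.
case: (Req_EM_T (l i) 0) => [->|ne]; first by rewrite Rmult_0_l; apply: Rle_refl.
have l00 : 0 < l i by have := l0 i; lra.
have : ln (l i) <= 0.
  case: l1 => [lt|->]; last by rewrite ln_1; apply: Rle_refl.
  rewrite -ln_1; apply: Rlt_le; exact: ln_increasing.
by move=> h1; have := Rmult_le_compat_l _ _ _ (l0 i) h1; rewrite Rmult_0_r.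
Qed.

End Entropy.

(** * Tensor products and partial traces for a bipartite system *)

Record bip (I J K : finType) := Bip {
  join : J -> K -> I;
  projl : I -> J;
  projr : I -> K;
  projlK : forall j k, projl (join j k) = j;
  projrK : forall j k, projr (join j k) = k;
  joinK : forall i, join (projl i) (projr i) = i }.

(** The index set is a product only up to the bijection [bip], because configurations of a union of
    regions are not literally pairs. One theory of tensors and partial traces then serves every
    splitting. *)
Section Bipartite.
Variables (I J K : finType) (m : bip I J K).
Implicit Types (rho : mx I) (X V : mx J) (Y W : mx K).

Lemma big_join T (idx : T) (op : Monoid.com_law idx) (F : I -> T) :
  \big[op/idx]_i F i = \big[op/idx]_j \big[op/idx]_k F (join m j k).
Proof.
rewrite pair_bigA /= (reindex (fun x => join m x.1 x.2)) //=.
exists (fun i => (projl m i, projr m i)) => [[j k] _|i _] /=.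
  by rewrite projlK projrK.
by rewrite joinK.
Qed.

Lemma join_eq j k j' k' : (join m j k == join m j' k') = (j == j') && (k == k').
Proof.
apply/eqP/andP => [e|[/eqP -> /eqP ->]] //.
by split; apply/eqP; rewrite -?[LHS](projlK m j k) -?[LHS](projrK m j k) e ?projlK ?projrK.
Qed.

Definition tens X Y : mx I :=
  fun i i' => Cmul (X (projl m i) (projl m i')) (Y (projr m i) (projr m i')).

Lemma tensE X Y j k j' k' :
  tens X Y (join m j k) (join m j' k') = Cmul (X j j') (Y k k').
Proof. by rewrite /tens !projlK !projrK. Qed.

Lemma bip_ext (A B : mx I) :
  (forall j k j' k', A (join m j k) (join m j' k') = B (join m j k) (join m j' k')) -> A = B.
Proof. by move=> h; apply: mx_ext => i i'; rewrite -(joinK m i) -(joinK m i'). Qed.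

Lemma tensM X Y X' Y' : mmul (tens X Y) (tens X' Y') = tens (mmul X X') (mmul Y Y').
Proof.
apply: bip_ext => j k j' k'; rewrite tensE /mmul big_join /= big_distrl /=.
apply: eq_bigr => a _; rewrite big_distrr /=; apply: eq_bigr => b _.
by rewrite !tensE; ring.
Qed.

Lemma tens_adj X Y : adj (tens X Y) = tens (adj X) (adj Y).
Proof. by apply: mx_ext => i i'; rewrite /adj /tens CconjM. Qed.

Lemma tens_diag l q :
  tens (diagR l) (diagR q) = diagR (fun i => l (projl m i) * q (projr m i)).
Proof.
apply: bip_ext => j k j' k'; rewrite tensE /diagR join_eq projlK projrK.
by case: eqP => _ /=; [case: eqP => _ /=|]; apply: C_ext => /=; ring.
Qed.

Lemma tens1 : tens (@mx1 J) (@mx1 K) = @mx1 I.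
Proof.
apply: bip_ext => j k j' k'; rewrite tensE /mx1 join_eq.
by case: eqP => _ /=; [case: eqP => _ /=|]; ring.
Qed.

Lemma tens_unitary V W : unitary V -> unitary W -> unitary (tens V W).
Proof. by move=> [a b] [c d]; split; rewrite tens_adj tensM ?a ?b ?c ?d tens1. Qed.

Lemma tens_spec X V l Y W q : is_spec X V l -> is_spec Y W q ->
  is_spec (tens X Y) (tens V W) (fun i => l (projl m i) * q (projr m i)).
Proof.
move=> [hV ->] [hW ->]; split; first exact: tens_unitary.
by rewrite -tens_diag tens_adj !tensM.
Qed.

Definition ptr rho : mx J := fun j j' => \big[Cadd/C0]_k rho (join m j k) (join m j' k).

(** The partial trace is dual to X -> X (x) 1; this supplies the trace hypotheses of
    [kl_monotone]. *)
Lemma tr_ptr rho X : mtr (mmul rho (tens X (@mx1 K))) = mtr (mmul (ptr rho) X).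
Proof.
rewrite /mtr big_join /=; apply: eq_bigr => j _.
rewrite /mmul; under eq_bigr do rewrite big_join /=.
rewrite exchange_big /=; apply: eq_bigr => j' _.
rewrite /ptr big_distrl /=; apply: eq_bigr => k _.
rewrite -[RHS](Csum_pick k (fun k' => Cmul (rho (join m j k) (join m j' k')) (X j' j))).
by apply: eq_bigr => k' _; rewrite tensE /mx1; case: eqP => _; ring.
Qed.

Lemma mtr_ptr rho : mtr (ptr rho) = mtr rho.
Proof. by rewrite -[X in mtr X = _]mmul1r -tr_ptr tens1 mmul1r. Qed.

(** Measuring in a product basis and forgetting the second outcome amounts to measuring the reduced
    operator: the sum over the columns of [W] collapses by W W' = 1. *)
Lemma wt_ptr rho V W j : unitary W ->
  \big[Rplus/R0]_k wt (tens V W) rho (join m j k) = wt V (ptr rho) j.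
Proof.
move=> [hW _].
have hWe a b : \big[Cadd/C0]_k Cmul (W b k) (Cconj (W a k)) = if b == a then C1 else C0.
  exact: (congr1 (fun A => A b a) hW).
rewrite /wt -Cre_sum; congr Cre.
transitivity (\big[Cadd/C0]_k \big[Cadd/C0]_a \big[Cadd/C0]_b \big[Cadd/C0]_a' \big[Cadd/C0]_b'
   Cmul (Cmul (Cconj (V a j)) (Cmul (rho (join m a b) (join m a' b')) (V a' j)))
     (Cmul (W b' k) (Cconj (W b k)))).
  apply: eq_bigr => k _; rewrite {1}/mmul big_join /=; apply: eq_bigr => a _.
  apply: eq_bigr => b _; rewrite /mmul big_join big_distrr /=; apply: eq_bigr => a' _.
  rewrite big_distrr /=; apply: eq_bigr => b' _.
  by rewrite /adj !tensE CconjM; ring.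
rewrite exchange_big /= /mmul; apply: eq_bigr => a _.
rewrite exchange_big /=.
under eq_bigr do rewrite exchange_big /=.
rewrite exchange_big big_distrr /=; apply: eq_bigr => a' _.
rewrite /ptr big_distrl big_distrr /=; apply: eq_bigr => b _.
rewrite exchange_big /=.
transitivity (\big[Cadd/C0]_b' (if b' == b then
   Cmul (Cconj (V a j)) (Cmul (rho (join m a b) (join m a' b')) (V a' j)) else C0)).
  apply: eq_bigr => b' _; rewrite -big_distrr /= hWe.
  by case: eqP => _; ring.
by rewrite Csum_pick.
Qed.

Lemma ptr_psd rho : psd rho -> psd (ptr rho).
Proof.
case=> hA h0; split.
  apply: mx_ext => j j'; rewrite /adj /ptr Csum_conj; apply: eq_bigr => k _.
  by rewrite -[in RHS]hA.
move=> v.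
(* The form of the reduced operator at v is the sum over k of the form of [rho] at v (x) e_k. *)
have -> : quad (ptr rho) v =
    \big[Cadd/C0]_k quad rho (fun i => if projr m i == k then v (projl m i) else C0).
  transitivity (\big[Cadd/C0]_k \big[Cadd/C0]_j \big[Cadd/C0]_j'
      Cmul (Cconj (v j)) (Cmul (rho (join m j k) (join m j' k)) (v j'))).
    rewrite [RHS]exchange_big; apply: eq_bigr => j _.
    rewrite [RHS]exchange_big; apply: eq_bigr => j' _.
    by rewrite /ptr big_distrl big_distrr.
  apply: eq_bigr => k _; rewrite /quad big_join; apply: eq_bigr => j _.
  rewrite -[LHS](Csum_pick k (fun k' => \big[Cadd/C0]_j'
      Cmul (Cconj (v j)) (Cmul (rho (join m j k') (join m j' k)) (v j')))).
  apply: eq_bigr => k' _; rewrite projlK projrK; case: eqP => _; last first.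
    by rewrite big1 // => i _; rewrite Cconj0; ring.
  rewrite big_join; apply: eq_bigr => j' _.
  rewrite -[LHS](Csum_pick k (fun k2 =>
      Cmul (Cconj (v j)) (Cmul (rho (join m j k') (join m j' k2)) (v j')))).
  by apply: eq_bigr => k2 _; rewrite projlK projrK; case: eqP => _ //; ring.
by rewrite Cre_sum; apply: Rsum_ge0.
Qed.

End Bipartite.

Lemma spec_mx1 (K : finType) : is_spec (@mx1 K) (@mx1 K) (fun=> 1).
Proof. by split; [split; rewrite adj1 mmul1|rewrite mmul1 adj1 mmul1r]. Qed.

Lemma unitary1 (K : finType) : unitary (@mx1 K).
Proof. exact: (proj1 (spec_mx1 K)). Qed.

(* [negent rho - negent (ptr m rho)] is minus the conditional entropy S(I | J). *)
Lemma kl_marginal (I J K : finType) (m : bip I J K) (rho U : mx I) p (V : mx J) q :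
  psd rho -> is_spec rho U p -> (forall i, 0 <= p i) ->
  is_spec (ptr m rho) V q -> (forall j, 0 <= q j) ->
  let W := tens m V (@mx1 K) in let qW := fun i => q (projl m i) * 1 in
  kl U W p qW = negent rho - negent (ptr m rho) /\ (forall i, qW i = 0 -> wt W rho i = 0).
Proof.
move=> rho0 hU p0 hV q0 W qW.
(* In an eigenbasis of the reduced operator, the first marginal of the measured law is its
   spectrum. *)
have marg j : \big[Rplus/R0]_k wt W rho (join m j k) = q j.
  by rewrite wt_ptr ?(wt_spec _ hV) //; apply: unitary1.
split.
  rewrite (klE hU (tens_spec m hV (spec_mx1 K))) (negentE hU p0) (negentE hV q0).
  congr (_ - _); rewrite (big_join m); apply: eq_bigr => j _.
  rewrite -(marg j) big_distrl /=; apply: eq_bigr => k _.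
  by rewrite /qW projlK Rmult_1_r marg.
move=> i; rewrite /qW Rmult_1_r -marg => /Rsum_ge0_eq0 h.
by rewrite -(joinK m i); apply: h => k; apply: wt_ge0.
Qed.

(** Parts 1, 2, 3 have index types [J], [K], [L]. Both sides are values of [kl]: the right one for
    rho and rho_13 (x) 1, the left one for rho_12 and rho_1 (x) 1. The second pair arises from the
    first by tracing out part 3, so monotonicity applies with the lift X -> X (x) 1. *)
Theorem strong_subadditivity (I I12 I13 J K L : finType)
    (m12 : bip I I12 L) (m13 : bip I I13 K) (n12 : bip I12 J K) (n13 : bip I13 J L) (rho : mx I) :
  (forall j k l, join m12 (join n12 j k) l = join m13 (join n13 j l) k) ->
  psd rho ->
  negent (ptr m12 rho) - negent (ptr n12 (ptr m12 rho)) <= negent rho - negent (ptr m13 rho).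
Proof.
move=> compat rho0.
have ptr2 : ptr n13 (ptr m13 rho) = ptr n12 (ptr m12 rho).
  apply: mx_ext => j j'; rewrite /ptr exchange_big /=.
  by apply: eq_bigr => k _; apply: eq_bigr => l _; rewrite !compat.
have [U [p [hU p0]]] := psd_spec rho0.
have rho12 := ptr_psd m12 rho0; have rho13 := ptr_psd m13 rho0.
have [U' [p' [hU' p0']]] := psd_spec rho12.
have [V [q [hV q0]]] := psd_spec rho13.
have [V' [q' [hV' q0']]] := psd_spec (ptr_psd n12 rho12).
have [<- supp] := kl_marginal rho0 hU p0 hV q0.
have [<- supp'] := kl_marginal rho12 hU' p0' hV' q0'.
apply: (@kl_monotone _ _ _ _ _ _ _ _ _ _ _ _ _ _ (fun X => tens m12 X (@mx1 L))
  hU (tens_spec m13 hV (spec_mx1 K)) hU' (tens_spec n12 hV' (spec_mx1 K))) => //.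
- by move=> i; have := q0 (projl m13 i); lra.
- by move=> i; have := q0' (projl n12 i); lra.
- by move=> X; rewrite tens_adj adj1.
- by move=> X Y; rewrite tensM mmul1.
- by rewrite mtr_ptr.
- by move=> X; rewrite tr_ptr.
(* The remaining trace condition: tracing part 3 out of rho_13 (x) 1 leaves rho_1 (x) 1. *)
move=> X; rewrite tr_ptr; congr (mtr (mmul _ X)).
apply: (bip_ext (m := n12)) => j k j' k'; rewrite tensE {1}/ptr.
under eq_bigr do rewrite !compat tensE.
by rewrite -big_distrl -ptr2.
Qed.

(** * Regions of the lattice *)

(** From A B = 1 follows diag(l) U' B = U'. If l_i = 0, row i of the left side is zero, while U' U
    has diagonal entry 1. *)
Lemma invertible_spec_neq0 (I : finType) (A U : mx I) l :
  is_spec A U l -> full_rank A -> forall i, l i <> 0.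
Proof.
move=> [hU eA] [B [AB _]] i li0.
have e : mmul (diagR l) (mmul (adj U) B) = adj U.
  rewrite -[LHS](unitaryKV _ hU).
  have -> : mmul U (mmul (diagR l) (mmul (adj U) B)) = mmul A B by rewrite eA -!mmulA.
  by rewrite AB mmul1r.
have : mmul (mmul (diagR l) (mmul (adj U) B)) U i i = C1.
  by rewrite e (proj2 hU) /mx1 eqxx.
rewrite -mmulA diag_mul li0 => /(congr1 fst) /=; lra.
Qed.

Lemma ln_prod (I : finType) (P : pred I) (F : I -> R) :
  (forall i, P i -> 0 < F i) ->
  0 < \big[Rmult/R1]_(i | P i) F i /\
  ln (\big[Rmult/R1]_(i | P i) F i) = \big[Rplus/R0]_(i | P i) ln (F i).
Proof.
move=> F0; elim/big_rec2: _ => [|i x y Pi [y0 <-]]; first by rewrite ln_1; split=> //; lra.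
by have Fi := F0 i Pi; rewrite ln_mult //; split=> //; apply: Rmult_lt_0_compat.
Qed.

Section Configurations.
Variables (n : nat) (d : 'I_n -> nat).
Implicit Types (A B D : {set 'I_n}).
Local Notation raw := {ffun 'I_n -> 'I_(dmax d)}.

Definition raw0 : 'I_(dmax d) := ord0.

(** Values outside the region or beyond the local dimension are reset to the filler 0, so [restr] is
    total on raw functions. *)
Definition clip A (h : raw) : raw :=
  [ffun k => if (k \in A) && (h k <= d k)%N then h k else raw0].

Lemma clip_good A h : good A (clip A h).
Proof.
by apply/forallP => k; rewrite ffunE; case: (k \in A) => //=; case: ifP.
Qed.

Definition restr A h : cfg d A := exist _ (clip A h) (clip_good A h).

Lemma cfg_le A (f : cfg d A) k : (val f k <= d k)%N.
Proof.
by move/forallP/(_ k): (valP f); case: ifP => // _ /eqP ->.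
Qed.

Lemma cfg_out A (f : cfg d A) k : k \notin A -> val f k = raw0.
Proof.
by move/forallP/(_ k): (valP f); case: ifP => // _ /eqP h _; apply: val_inj.
Qed.

Lemma cfg_ext A (f g : cfg d A) : (forall k, k \in A -> val f k = val g k) -> f = g.
Proof.
move=> h; apply: val_inj; apply/ffunP => k.
by case: (boolP (k \in A)) => [/h //|kA]; rewrite !cfg_out.
Qed.

Lemma restr_val A (h : raw) k : k \in A -> (h k <= d k)%N -> val (restr A h) k = h k.
Proof. by move=> kA hk; rewrite /= ffunE kA hk. Qed.

Definition coord A (f : cfg d A) (k : 'I_n) : 'I_(d k).+1 := inord (val f k).

Lemma coord_inj A (f g : cfg d A) k : coord f k = coord g k -> val f k = val g k.
Proof.
move/(congr1 val); rewrite /coord !val_insubd /= !ltnS !cfg_le => e.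
exact: val_inj.
Qed.

Section Partition.
Variables (A B D : {set 'I_n}).
Hypothesis cover : forall k, (k \in D) = (k \in A) || (k \in B).
Hypothesis disj : forall k, k \in A -> k \notin B.

Definition merge (a : cfg d A) (b : cfg d B) : cfg d D :=
  restr D [ffun k => if k \in A then val a k else val b k].

Lemma val_merge a b k : val (merge a b) k = if k \in A then val a k else val b k.
Proof.
case: (boolP (k \in D)) => [kD|kD].
  by rewrite /merge restr_val ?ffunE //; case: ifP => _; apply: cfg_le.
rewrite cfg_out //; move: kD; rewrite cover negb_or => /andP [/negbTE -> kB].
by rewrite cfg_out.
Qed.

Lemma merge_projl a b : restr A (val (merge a b)) = a.
Proof. by apply: cfg_ext => k kA; rewrite restr_val ?cfg_le // val_merge kA. Qed.

Lemma merge_projr a b : restr B (val (merge a b)) = b.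
Proof.
apply: cfg_ext => k kB; rewrite restr_val ?cfg_le // val_merge.
by case: (boolP (k \in A)) => // /disj; rewrite kB.
Qed.

Lemma mergeK (f : cfg d D) : merge (restr A (val f)) (restr B (val f)) = f.
Proof.
apply: cfg_ext => k; rewrite cover val_merge.
by case: (boolP (k \in A)) => kA /= kB; rewrite restr_val ?cfg_le.
Qed.

Definition cfg_bip : bip (cfg d D) (cfg d A) (cfg d B) :=
  @Bip (cfg d D) (cfg d A) (cfg d B) merge (fun f => restr A (val f))
    (fun f => restr B (val f)) merge_projl merge_projr mergeK.

End Partition.

(** The constraint in [ptrace] forces [f] to restrict to [a] on [A], and then leaves a single [g]:
    the one merging [b] with the part of [f] outside [A]. *)
Lemma ptrace_ptr A B (cover : forall k, (k \in setT) = (k \in A) || (k \in B))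
    (disj : forall k, k \in A -> k \notin B) (rho : mx (cfg d setT)) :
  ptrace A rho = ptr (cfg_bip cover disj) rho.
Proof.
set m := cfg_bip cover disj.
have notA k : (k \in A) = false -> k \in B by move=> kA; have := cover k; rewrite inE kA.
apply: mx_ext => a b; rewrite /ptrace (big_join m) /=.
rewrite -[RHS](Csum_pick a (fun a' => \big[Cadd/C0]_c rho (join m a' c) (join m b c))).
apply: eq_bigr => a' _.
have [->|ne] := eqVneq a' a; last first.
  apply: big1 => c _; apply: big_pred0 => g; apply/negP => /forallP h.
  case/eqP: ne; apply: cfg_ext => k kA; have := h k; rewrite kA => /andP [/eqP + _].
  by rewrite val_merge // kA.
apply: eq_bigr => c _; apply: big_pred1 => g; apply/forallP/eqP => [h|-> k].
  apply: cfg_ext => k _; have := h k; rewrite !val_merge //.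
  by case: (k \in A) => [/andP [_ /eqP]|/eqP].
by rewrite !val_merge //; case: (k \in A); rewrite !eqxx.
Qed.

Lemma ptrace_full (rho : mx (cfg d setT)) : ptrace setT rho = rho.
Proof.
apply: mx_ext => a b; rewrite /ptrace.
rewrite -[RHS](Csum_pick a (fun f => rho f b)); apply: eq_bigr => f _.
have [->|ne] := eqVneq f a; last first.
  apply: big_pred0 => g; apply/negP => /forallP h; case/eqP: ne.
  by apply: cfg_ext => k kT; have := h k; rewrite kT => /andP [/eqP].
apply: big_pred1 => g; apply/forallP/eqP => [h|-> k]; last by rewrite inE !eqxx.
by apply: cfg_ext => k kT; have := h k; rewrite kT => /andP [_ /eqP].
Qed.

(** * Product operators on a region *)

Lemma sum_cfg_prod A (G : forall k, 'I_(d k).+1 -> C) :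
  \big[Cadd/C0]_(f : cfg d A) \big[Cmul/C1]_(k in A) G k (coord f k) =
  \big[Cmul/C1]_(k in A) \big[Cadd/C0]_v G k v.
Proof.
(* All local sums are moved to the common alphabet ['I_(dmax d)], as distributing a product over
   sums requires one codomain. *)
have e k : \big[Cadd/C0]_v G k v =
    \big[Cadd/C0]_(j : 'I_(dmax d) | (j <= d k)%N) G k (inord j).
  rewrite (big_ord_narrow_leq (leq_bigmax k)) /=.
  by apply: eq_bigr => v _; rewrite inord_val.
rewrite [RHS](eq_bigr _ (fun k _ => e k)) (big_distr_big_dep raw0) /=.
rewrite -(@big_sub _ _ _ _ (@good n d A) (fun f => \big[Cmul/C1]_(k in A) G k (inord (f k)))) /=.
(* The predicate [good] describes exactly the functions supported in [A] whose values there respect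
   the local dimensions. *)
apply: eq_bigl => f; apply/forallP/pfamilyP => [h|[/supportP h1 h2] k].
  split; first by apply/supportP => k kA; have := h k; rewrite (negbTE kA) => /eqP ?; apply: val_inj.
  by move=> k kA; have := h k; rewrite kA.
by case: ifP => [/h2 //|/negbT /h1 ->].
Qed.

Definition prodA A (s : forall k, mx 'I_((d k).+1)) : mx (cfg d A) :=
  fun f g => \big[Cmul/C1]_(k in A) s k (coord f k) (coord g k).
Arguments prodA A s : clear implicits.

Lemma prodA_full s : prod_mx s = prodA setT s.
Proof. by apply: mx_ext => f g; apply: eq_bigl => k; rewrite inE. Qed.

Lemma prodA_mul A s t : mmul (prodA A s) (prodA A t) = prodA A (fun k => mmul (s k) (t k)).
Proof.
apply: mx_ext => f g; rewrite /mmul /prodA -(@sum_cfg_prod A (fun k v =>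
  Cmul (s k (coord f k) v) (t k v (coord g k)))).
by apply: eq_bigr => h _; rewrite -big_split.
Qed.

Lemma prodA_adj A s : adj (prodA A s) = prodA A (fun k => adj (s k)).
Proof. by apply: mx_ext => f g; rewrite /adj Cprod_conj. Qed.

Lemma prodA_diag A (l : forall k, 'I_(d k).+1 -> R) :
  prodA A (fun k => diagR (l k)) =
  diagR (fun f : cfg d A => \big[Rmult/R1]_(k in A) l k (coord f k)).
Proof.
apply: mx_ext => f g; rewrite /prodA /diagR.
have [->|ne] := eqVneq f g.
  by rewrite RtoC_prod; apply: eq_bigr => k _; rewrite eqxx.
have [k /andP [kA kne]] : exists k, (k \in A) && (val f k != val g k).
  apply/existsP; apply: contraR ne; rewrite negb_exists => /forallP h.
  apply/eqP; apply: cfg_ext => k kA; have := h k; rewrite kA negbK.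
  by move/eqP.
rewrite (bigD1 k) //=; case: eqP => [/coord_inj e|_]; first by rewrite e eqxx in kne.
by rewrite Cmul0.
Qed.

Lemma prodA1 A : prodA A (fun k => @mx1 _) = @mx1 _.
Proof.
rewrite (_ : (fun k => _) = (fun k => diagR (fun _ : 'I_(d k).+1 => 1))) //.
rewrite prodA_diag; apply: mx_ext => f g; rewrite /diagR /mx1.
by case: eqP => // _; rewrite big1.
Qed.

Lemma prodA_spec A s U l : (forall k, is_spec (s k) (U k) (l k)) ->
  is_spec (prodA A s) (prodA A U)
    (fun f : cfg d A => \big[Rmult/R1]_(k in A) l k (coord f k)).
Proof.
move=> h.
have eU V W : (forall k, mmul (V k) (W k) = @mx1 _) -> mmul (prodA A V) (prodA A W) = @mx1 _.
  move=> e; rewrite prodA_mul -prodA1; apply: mx_ext => f g.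
  by apply: eq_bigr => k _; rewrite e.
split.
  by split; rewrite prodA_adj eU // => k; case: (h k) => [[]].
rewrite -prodA_diag prodA_adj !prodA_mul; apply: mx_ext => f g.
by apply: eq_bigr => k _; rewrite -(proj2 (h k)).
Qed.

Lemma mtr_prodA A s : mtr (prodA A s) = \big[Cmul/C1]_(k in A) mtr (s k).
Proof. exact: (@sum_cfg_prod A (fun k v => s k v v)). Qed.

Lemma prodA_tens A B D (cover : forall k, (k \in D) = (k \in A) || (k \in B))
    (disj : forall k, k \in A -> k \notin B) s :
  prodA D s = tens (cfg_bip cover disj) (prodA A s) (prodA B s).
Proof.
apply: (bip_ext (m := cfg_bip cover disj)) => a b a' b'; rewrite tensE /prodA /=.
rewrite (eq_bigl (fun k => (k \in A) || (k \in B))) //.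
rewrite bigU /=; last first.
  by rewrite disjoint_subset; apply/subsetP => k /disj; rewrite inE.
congr Cmul; apply: eq_bigr => k kA; rewrite /coord !val_merge ?kA //.
by case: (boolP (k \in A)) => // /disj; rewrite kA.
Qed.

(** The factor on [B] contributes only its trace, which is a product of site traces equal to 1. *)
Lemma ptrace_prodA A B (cover : forall k, (k \in setT) = (k \in A) || (k \in B))
    (disj : forall k, k \in A -> k \notin B) s :
  (forall k, mtr (s k) = C1) -> ptrace A (prodA setT s) = prodA A s.
Proof.
move=> s1; rewrite (ptrace_ptr cover disj) (prodA_tens cover disj).
apply: mx_ext => a b; rewrite /ptr.
under eq_bigr do rewrite tensE.
rewrite -big_distrr /= -[X in Cmul _ X]/(mtr (prodA B s)) mtr_prodA big1 => [|k _] //.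
by rewrite Cmul1r.
Qed.

End Configurations.
Arguments prodA {n d} A s.
Arguments cfg_bip {n d A B D} cover disj.

(** * Han's inequality and product reference states *)

Lemma telescope_ord (f : nat -> R) n :
  \big[Rplus/R0]_(i < n) (f i.+1 - f i) = f n - f 0%N.
Proof.
elim: n => [|n IH]; first by rewrite big_ord0 -[R0]/0; ring.
by rewrite big_ord_recr /= IH; ring.
Qed.

Section Han.
Variables (n : nat) (d : 'I_n -> nat) (rho : mx (cfg d setT)).

Definition initial (i : nat) : {set 'I_n} := [set k : 'I_n | (k < i)%N].

Definition region_negent (A : {set 'I_n}) : R := negent (ptrace A rho).

(** Strong subadditivity with the sites before [x] as part 1, [x] itself as part 2, and the sites
    after [x] as part 3. *)
Lemma cond_entropy_monotone (x : 'I_n) : psd rho ->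
  region_negent (initial x.+1) - region_negent (initial x) <=
  region_negent setT - region_negent [set~ x].
Proof.
move=> rho0; rewrite /region_negent ptrace_full.
pose L : {set 'I_n} := [set k : 'I_n | (x < k)%N]; pose N : {set 'I_n} := [set k : 'I_n | (x <= k)%N].
have c12 (k : 'I_n) : (k \in setT) = (k \in initial x.+1) || (k \in L) by rewrite !inE ltnS; case: leqP.
have d12 (k : 'I_n) : k \in initial x.+1 -> k \notin L by rewrite !inE ltnS -leqNgt.
have c13 (k : 'I_n) : (k \in setT) = (k \in [set~ x]) || (k \in [set x]) by rewrite !inE; case: eqP.
have d13 (k : 'I_n) : k \in [set~ x] -> k \notin [set x] by rewrite !inE.
have e12 (k : 'I_n) : (k \in initial x.+1) = (k \in initial x) || (k \in [set x]).
  by rewrite !inE ltnS leq_eqVlt orbC.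
have f12 (k : 'I_n) : k \in initial x -> k \notin [set x] by rewrite !inE -val_eqE neq_ltn => ->.
have e13 (k : 'I_n) : (k \in [set~ x]) = (k \in initial x) || (k \in L).
  by rewrite !inE -val_eqE neq_ltn.
have f13 (k : 'I_n) : k \in initial x -> k \notin L by rewrite !inE -leqNgt; apply: ltnW.
have c1 (k : 'I_n) : (k \in setT) = (k \in initial x) || (k \in N) by rewrite !inE; case: leqP.
have d1 (k : 'I_n) : k \in initial x -> k \notin N by rewrite !inE -ltnNge.
have eN (k : 'I_n) : (k \in N) = (k \in [set x]) || (k \in L).
  by rewrite !inE leq_eqVlt eq_sym.
have fN (k : 'I_n) : k \in [set x] -> k \notin L by rewrite !inE => /eqP ->; rewrite ltnn.
rewrite (ptrace_ptr c12 d12) (ptrace_ptr c13 d13).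
(* Tracing out all sites from [x] on at once agrees with tracing out first those after [x], then
   [x]. *)
have -> : ptrace (initial x) rho = ptr (cfg_bip e12 f12) (ptr (cfg_bip c12 d12) rho).
  rewrite (ptrace_ptr c1 d1); apply: mx_ext => j j'.
  rewrite /ptr (big_join (cfg_bip eN fN)) /=; apply: eq_bigr => a _; apply: eq_bigr => l _.
  congr rho; apply: cfg_ext => k _; rewrite !val_merge // e12;
    by case: (k \in initial x); case: (k \in [set x]).
apply: (strong_subadditivity (n13 := cfg_bip e13 f13)) => // j a l.
apply: cfg_ext => k _; rewrite !val_merge // e12 e13.
by case: (boolP (k \in initial x)) => //= _; case: (boolP (k \in [set x])) => [/fN /negbTE ->|];
  case: (boolP (k \in L)) => // kL kx; rewrite !cfg_out.
Qed.

Theorem negent_le_sum : psd rho -> mtr rho = C1 ->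
  region_negent setT <= \big[Rplus/R0]_(x : 'I_n) (region_negent setT - region_negent [set~ x]).
Proof.
move=> rho0 tr1; apply: (Rle_trans _ (region_negent (initial n) - region_negent (initial 0))).
  have -> : initial n = setT by apply/setP => k; rewrite !inE ltn_ord.
  (* The telescoped sum starts at the empty region, whose entropy only has to be nonnegative. *)
  suff : region_negent (initial 0) <= 0 by lra.
  have c (k : 'I_n) : (k \in setT) = (k \in initial 0) || (k \in [set: 'I_n]) by rewrite !inE.
  have e (k : 'I_n) : k \in initial 0 -> k \notin [set: 'I_n] by rewrite !inE.
  rewrite /region_negent (ptrace_ptr c e); apply: negent_le0; first exact: ptr_psd.
  by rewrite mtr_ptr tr1.
rewrite -(telescope_ord (fun i => region_negent (initial i))).
by apply: Rsum_le => x _; apply: cond_entropy_monotone.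
Qed.

End Han.

Lemma is_state_psd (I : finType) (A : mx I) : is_state A -> psd A.
Proof. by case=> hA [h0 _]. Qed.

(** * Relative entropy with respect to a product state *)

Section ProductReference.
Variables (n : nat) (d : 'I_n -> nat) (rho : mx (cfg d setT)).
Variables (s U : forall k : 'I_n, mx 'I_((d k).+1)) (l : forall k, 'I_(d k).+1 -> R).
Arguments s : clear implicits.
Arguments U : clear implicits.
Arguments l : clear implicits.
Hypothesis sP : forall k, is_spec (s k) (U k) (l k).
Hypothesis l_gt0 : forall k v, 0 < l k v.
Hypothesis s_tr : forall k, mtr (s k) = C1.

(* The law of the outcomes when all sites are measured in the eigenbases of the [s k]. *)
Let w (f : cfg d setT) : R := wt (prodA setT U) rho f.

(** The logarithm of a product eigenvalue is a sum of one-site logarithms, and the law of outcomes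
    on [A] is a marginal of [w]. Hence the same [w] serves every region, and cross terms of
    different regions can be compared site by site. *)
Lemma cross_term A : Cre (mtr (mmul (ptrace A rho) (mlog (prodA A s)))) =
  \big[Rplus/R0]_f (w f * \big[Rplus/R0]_(k in A) ln (l k (coord f k))).
Proof.
have c (k : 'I_n) : (k \in setT) = (k \in A) || (k \in ~: A) by rewrite !inE; case: (k \in A).
have e (k : 'I_n) : k \in A -> k \notin ~: A by rewrite !inE negbK.
have lP (B : {set 'I_n}) (f : cfg d B) := @ln_prod _ (mem B) (fun k => l k (coord f k))
  (fun k _ => l_gt0 _).
rewrite (Re_tr_mlog _ (prodA_spec A sP)); last by move=> f; apply: Rlt_le; case: (lP A f).
rewrite (big_join (cfg_bip c e)); apply: eq_bigr => a _.
rewrite (ptrace_ptr c e) -(@wt_ptr _ _ _ _ _ _ (prodA (~: A) U)); last first.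
  exact: (proj1 (prodA_spec (~: A) sP)).
rewrite big_distrl /=; apply: eq_bigr => b _; rewrite /w (prodA_tens c e).
congr (_ * _); rewrite (proj2 (lP A a)); apply: eq_bigr => k kA.
by rewrite /coord val_merge // [k \in A]kA.
Qed.

(** The cross terms of the full lattice and of the complement of [x] differ by the contribution of
    the site [x] alone. *)
Lemma relent_x_cond (x : 'I_n) : relent_x x rho (prod_mx s) =
  region_negent rho setT - region_negent rho [set~ x]
  - \big[Rplus/R0]_f (w f * ln (l x (coord f x))).
Proof.
have c (k : 'I_n) : (k \in setT) = (k \in [set~ x]) || (k \in [set x]) by rewrite !inE; case: eqP.
have e (k : 'I_n) : k \in [set~ x] -> k \notin [set x] by rewrite !inE.
rewrite /relent_x !relent_negent prodA_full (ptrace_prodA c e s_tr) -{2}(ptrace_full rho).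
rewrite !cross_term /region_negent ptrace_full.
have -> : \big[Rplus/R0]_f (w f * \big[Rplus/R0]_(k in setT) ln (l k (coord f k))) =
  \big[Rplus/R0]_f (w f * \big[Rplus/R0]_(k in [set~ x]) ln (l k (coord f k)))
  + \big[Rplus/R0]_f (w f * ln (l x (coord f x))).
  rewrite -big_split; apply: eq_bigr => f _ /=; rewrite -Rmult_plus_distr_l Rplus_comm.
  rewrite (bigD1 x) ?inE //=; congr (_ * (_ + _)).
  by apply: eq_bigl => k; rewrite !inE.
have ringE (a b t u : R) : a - (b + t) - (u - b) = a - u - t by ring.
exact: ringE.
Qed.

Lemma relent_prod : relent rho (prod_mx s) =
  region_negent rho setT
  - \big[Rplus/R0]_(x : 'I_n) \big[Rplus/R0]_f (w f * ln (l x (coord f x))).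
Proof.
rewrite relent_negent prodA_full -{2}(ptrace_full rho) cross_term /region_negent ptrace_full.
congr (_ - _); rewrite exchange_big; apply: eq_bigr => f _ /=.
by rewrite -big_distrr /=; congr (_ * _); apply: eq_bigl => k; rewrite inE.
Qed.

End ProductReference.

Theorem mainTheorem7 (n : nat) (d : 'I_n -> nat)
  (rho : mx (cfg d setT))
  (s : forall k : 'I_n, mx 'I_((d k).+1)) :
  is_state rho ->
  (forall k : 'I_n, is_state (s k) /\ full_rank (s k)) ->
  Rle (relent rho (prod_mx s))
     (\big[Rplus/R0]_(x : 'I_n) relent_x x rho (prod_mx s)).
Proof.
move=> rhoS sS.
have sspec k : exists U l, is_spec (s k) U l /\ forall v, 0 < l v.
  have [sk fk] := sS k; have [U [l [h l0]]] := psd_spec (is_state_psd sk).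
  (* Full rank excludes the eigenvalue 0, so the logarithm of a product of eigenvalues splits. *)
  exists U, l; split=> // v; have := invertible_spec_neq0 (i := v) h fk.
  by have := l0 v; lra.
(* Eigenbases and spectra are chosen for all sites at once. *)
have {}sspec k := constructive_indefinite_description _ (sspec k).
have {}sspec k : {U & {l | is_spec (s k) U l /\ forall v, 0 < l v}}.
  by have [U h] := sspec k; exists U; apply: constructive_indefinite_description.
pose U k := projT1 (sspec k); pose l k := proj1_sig (projT2 (sspec k)).
have sP k : is_spec (s k) (U k) (l k) by case: (proj2_sig (projT2 (sspec k))).
have l_gt0 k v : 0 < l k v by apply: (proj2 (proj2_sig (projT2 (sspec k)))).
have s_tr k : mtr (s k) = C1 by case: (sS k) => [[_ [_ ->]]].
have := negent_le_sum (is_state_psd rhoS) (proj2 (proj2 rhoS)).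
under [X in _ -> _ <= X]eq_bigr do rewrite (relent_x_cond rho sP l_gt0 s_tr).
(* Both sides carry the same total of one-site cross terms; removing it leaves Han's inequality
   [h]. *)
by move=> h; rewrite Rsum_sub (relent_prod rho sP l_gt0); apply: Rplus_le_compat_r.
Qed.
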